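(* Let $G$ be a finite group, let $*$ be a nonidentical involutory antiautomorphism of $G$ with $gg^*\in Z(G)$ for every $g\in G$, and let $g_0\in Z(G)$ with $g_0^*=g_0$. Let $\beta\in\{xy,\,x^*y,\,yx,\,yx^*\}$, $\gamma\in\{xy,\,yx\}$ and $\delta\in\{g_0xy,\,g_0xy^*,\,g_0x^*y,\,g_0x^*y^*,\,g_0yx,\,g_0yx^*,\,g_0y^*x,\,g_0y^*x^*\}$. Then the loop $L=Q(G,*,g_0,\beta,\gamma,\delta)$ is associative if and only if at least one of the following holds: (a) $(\beta,\gamma,\delta)=(xy,xy,g_0xy)$; (b) $G$ is commutative and $(\beta,\gamma,\delta)=(x^*y,xy,g_0x^*y)$.
   Context: $Z(G)$ is the center of $G$. An involutory antiautomorphism $*$ of $G$ satisfies $(g^* )^*=g$ and $(gh)^*=h^*g^*$; nonidentical means $g^*\neq g$ for some $g\in G$. A word such as $yx^*$ or $g_0y^*x$ denotes the function $G\times G\to G$ sending $(x,y)$ to the value of the word. Words are regarded as functions: two words are identified when they define the same function on $G\times G$ (for instance $xy$ and $yx$ when $G$ is commutative), and equality of triples $(\beta,\gamma,\delta)$ means equality of the three functions. Let $Gu=\{gu : g\in G\}$ be a disjoint copy of $G$. The loop $Q(G,*,g_0,\beta,\gamma,\delta)$ is the set $G\cup Gu$ with the multiplication, for $x,y\in G$, $$x\circ y=xy,\quad x\circ yu=\beta(x,y)u,\quad xu\circ y=\gamma(x,y)u,\quad xu\circ yu=\delta(x,y).$$ It is a loop with neutral element $1\in G$. *)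

(* Defs.v *)
From mathcomp Require Import all_boot all_fingroup all_solvable.

Set Implicit Arguments.
Unset Strict Implicit.
Unset Printing Implicit Defensive.

Import GroupScope.

(* Finite functions, so that Leibniz equality of words is equality as
   functions of two variables. *)
Definition word (gT : finGroupType) (f : gT -> gT -> gT) :
  {ffun gT * gT -> gT} := [ffun p : gT * gT => f p.1 p.2].

Notation "[ 'word' x y => e ]" := (word (fun x y => e))
  (at level 0, x name, y name, format "[ 'word'  x  y  =>  e ]").

Record nonid_inv_antiaut (gT : finGroupType) (star : gT -> gT) : Prop :=
  NonidInvAntiaut {
    star_invol : forall g : gT, star (star g) = g;
    star_anti : forall g h : gT, star (g * h) = star h * star g;
    star_nonid : exists g : gT, star g <> g
  }.

(* The disjoint union of G and Gu: [inl g] is g and [inr g] is gu. *)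
Definition Qset (gT : finGroupType) : Type := (gT + gT)%type.

Definition Qone (gT : finGroupType) : Qset gT := inl 1.

(* The parameters star and g0 of Q(G,*,g0,beta,gamma,delta) act only through
   the words beta, gamma and delta. *)
Definition Qmul (gT : finGroupType) (beta gamma delta : {ffun gT * gT -> gT})
    (a b : Qset gT) : Qset gT :=
  match a, b with
  | inl x, inl y => inl (x * y)
  | inl x, inr y => inr (beta (x, y))
  | inr x, inl y => inr (gamma (x, y))
  | inr x, inr y => inl (delta (x, y))
  end.

Definition beta_words (gT : finGroupType) (star : gT -> gT) :
    seq {ffun gT * gT -> gT} :=
  [:: [word x y => x * y]; [word x y => star x * y];
      [word x y => y * x]; [word x y => y * star x]].

Definition gamma_words (gT : finGroupType) : seq {ffun gT * gT -> gT} :=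
  [:: [word x y => x * y]; [word x y => y * x]].

Definition delta_words (gT : finGroupType) (star : gT -> gT) (g0 : gT) :
    seq {ffun gT * gT -> gT} :=
  [:: [word x y => g0 * x * y]; [word x y => g0 * x * star y];
      [word x y => g0 * star x * y]; [word x y => g0 * star x * star y];
      [word x y => g0 * y * x]; [word x y => g0 * y * star x];
      [word x y => g0 * star y * x]; [word x y => g0 * star y * star x]].

Definition is_loop (T : Type) (mul : T -> T -> T) (one : T) : Prop :=
  [/\ left_id one mul, right_id one mul,
      forall a, bijective (mul a) & forall b, bijective (mul^~ b)].

Lemma Qmul_is_loop (gT : finGroupType) (star : gT -> gT) (g0 : gT)
    (beta gamma delta : {ffun gT * gT -> gT}) :
  nonid_inv_antiaut star ->
  beta \in beta_words star -> gamma \in gamma_words gT ->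
  delta \in delta_words star g0 ->
  is_loop (Qmul beta gamma delta) (Qone gT).
Proof.
move=> [sK sM _] hb hc hd.
have s1 : star 1 = 1 by apply: (mulIg (star 1)); rewrite -sM !mul1g.
have sI : injective star by apply: can_inj sK.
have bR x y z : beta (x, y) = beta (x, z) -> y = z.
  move: hb; rewrite !inE => /or4P[] /eqP->; rewrite !ffunE /=;
    by do ?[move/mulgI | move/mulIg | move/sI].
have bL x y z : beta (x, z) = beta (y, z) -> x = y.
  move: hb; rewrite !inE => /or4P[] /eqP->; rewrite !ffunE /=;
    by do ?[move/mulgI | move/mulIg | move/sI].
have cR x y z : gamma (x, y) = gamma (x, z) -> y = z.
  move: hc; rewrite !inE => /orP[] /eqP->; rewrite !ffunE /=;
    by do ?[move/mulgI | move/mulIg | move/sI].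
have cL x y z : gamma (x, z) = gamma (y, z) -> x = y.
  move: hc; rewrite !inE => /orP[] /eqP->; rewrite !ffunE /=;
    by do ?[move/mulgI | move/mulIg | move/sI].
have dR x y z : delta (x, y) = delta (x, z) -> y = z.
  move: hd; rewrite !inE; do 7?case/predU1P=> [->|]; last (move/eqP->);
    rewrite !ffunE /=; by do ?[move/mulgI | move/mulIg | move/sI].
have dL x y z : delta (x, z) = delta (y, z) -> x = y.
  move: hd; rewrite !inE; do 7?case/predU1P=> [->|]; last (move/eqP->);
    rewrite !ffunE /=; by do ?[move/mulgI | move/mulIg | move/sI].
split.
- case=> y /=; first by rewrite mul1g.
  congr inr; move: hb; rewrite !inE.
  by case/or4P=> /eqP->; rewrite !ffunE /= ?s1 ?mul1g ?mulg1.
- case=> y /=; first by rewrite mulg1.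
  congr inr; move: hc; rewrite !inE.
  by case/orP=> /eqP->; rewrite !ffunE /= ?mul1g ?mulg1.
- move=> a; apply: (@injF_bij (gT + gT)%type).
  by case: a => x [y|y] [z|z] //= [] => [/mulgI|/bR|/cR|/dR] ->.
- move=> b; apply: (@injF_bij (gT + gT)%type).
  by case: b => z [x|x] [y|y] //= [] => [/mulIg|/cL|/bL|/dL] ->.
Qed.

(* Main.v *)
Require Import Defs.
From mathcomp Require Import all_boot all_fingroup all_solvable.
Import GroupScope.

Set Implicit Arguments.
Unset Strict Implicit.

(* Associativity of triples with exactly one factor in Gu says that beta is a
   left action and gamma a right action of G on itself, and that they commute.
   This forces gamma (x, y) = xy, and then beta (x, y) = xy unless G is
   commutative and beta (x, y) = x^* y. Triples with two factors in Gu determine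
   delta from beta, gamma and the value delta (1, 1) = g0. *)

Lemma abelian_setTP (gT : finGroupType) :
  reflect (forall x y : gT, x * y = y * x) (abelian [set: gT]).
Proof.
apply: (iffP centsP) => [cG x y | cG x _ y _]; last exact: cG.
by apply: cG; rewrite inE.
Qed.

(** Each of the three factors lies in [G] or in [Gu]. The triple inside [G] is associativity of [G];
    the other seven give the laws, grouped by having one, two or three factors in [Gu]. *)
Lemma Qmul_associativeP (gT : finGroupType)
    (beta gamma delta : {ffun gT * gT -> gT}) :
  associative (Qmul beta gamma delta) <->
  [/\ [/\ forall x y z, beta (x, beta (y, z)) = beta (x * y, z),
          forall x y z, beta (x, gamma (y, z)) = gamma (beta (x, y), z) &
          forall x y z, gamma (x, y * z) = gamma (gamma (x, y), z)],
      [/\ forall x y z, x * delta (y, z) = delta (beta (x, y), z),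
          forall x y z, delta (x, beta (y, z)) = delta (gamma (x, y), z) &
          forall x y z, delta (x, gamma (y, z)) = delta (x, y) * z] &
      forall x y z, gamma (x, delta (y, z)) = beta (delta (x, y), z)].
Proof.
split=> [A | [[A1 A2 A3] [A4 A5 A6] A7] [x|x] [y|y] [z|z] /=].
- split; [split | split |] => x y z.
  + by have [] := A (inl x) (inl y) (inr z).
  + by have [] := A (inl x) (inr y) (inl z).
  + by have [] := A (inr x) (inl y) (inl z).
  + by have [] := A (inl x) (inr y) (inr z).
  + by have [] := A (inr x) (inl y) (inr z).
  + by have [] := A (inr x) (inr y) (inl z).
  + by have [] := A (inr x) (inr y) (inr z).
- by rewrite mulgA.
- by rewrite A1.
- by rewrite A2.
- by rewrite A4.
- by rewrite A3.
- by rewrite A5.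
- by rewrite A6.
- by rewrite A7.
Qed.

Lemma star1 (gT : finGroupType) (star : gT -> gT)
    (hstar : nonid_inv_antiaut star) :
  star 1 = 1.
Proof. by apply: (mulIg (star 1)); rewrite -(star_anti hstar) !mul1g. Qed.

(** For the word [y * x], the action law starting from [1] reads [x * y = y * x], so both words are
    then the same function. *)
Lemma gamma_action_eq_mul (gT : finGroupType) (gamma : {ffun gT * gT -> gT}) :
  gamma \in gamma_words gT ->
  (forall x y z, gamma (x, y * z) = gamma (gamma (x, y), z)) ->
  gamma = [word x y => x * y].
Proof.
rewrite !inE => /orP[] /eqP-> // A; apply/ffunP=> -[x y]; rewrite !ffunE /=.
by have := A 1 x y; rewrite !ffunE /= !mulg1.
Qed.

(** The second law is the commutation of [beta] with [gamma], once [gamma] is multiplication. It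
    makes [G] commutative for the two words with [y] on the left, which then coincide with the other
    two. *)
Lemma beta_action_eq_mul (gT : finGroupType) (star : gT -> gT)
    (beta : {ffun gT * gT -> gT}) (hstar : nonid_inv_antiaut star) :
  beta \in beta_words star ->
  (forall x y z, beta (x, beta (y, z)) = beta (x * y, z)) ->
  (forall x y z, beta (x, y * z) = beta (x, y) * z) ->
  beta = [word x y => x * y] \/
  abelian [set: gT] /\ beta = [word x y => star x * y].
Proof.
rewrite !inE => /or4P[] /eqP-> A1 A2; first by left.
- right; split=> //; apply/abelian_setTP => x y.
  (* The action law makes [star] multiplicative as well as antimultiplicative, and [star] is
     injective. *)
  apply: (can_inj (star_invol hstar)).
  by have := A1 y x 1; rewrite !ffunE /= !mulg1 (star_anti hstar) => ->.
- left; apply/ffunP=> -[x y]; rewrite !ffunE /=.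
  by have := A2 x 1 y; rewrite !ffunE /= !mul1g.
- have cG (x y : gT) : x * y = y * x.
    (* The first argument is [star y] so that [beta] turns it back into [y]. *)
    have := A2 (star y) 1 x.
    by rewrite !ffunE /= (star_invol hstar) !mul1g.
  right; split; first exact/abelian_setTP.
  by apply/ffunP=> -[x y]; rewrite !ffunE /= cG.
Qed.

(** All eight words agree at this point because [star 1 = 1]; this spares a case analysis on [delta]
    later. *)
Lemma delta_word11 (gT : finGroupType) (star : gT -> gT) (g0 : gT)
    (delta : {ffun gT * gT -> gT}) (hstar : nonid_inv_antiaut star) :
  delta \in delta_words star g0 -> delta (1, 1) = g0.
Proof.
rewrite !inE; do 7?case/predU1P=> [->|]; last move/eqP->;
  by rewrite ffunE /= ?(star1 hstar) !mulg1.
Qed.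

Theorem theorem8p1 (gT : finGroupType) (star : gT -> gT) (g0 : gT)
    (beta gamma delta : {ffun gT * gT -> gT})
    (hstar : nonid_inv_antiaut star)
    (hcent : forall g : gT, g * star g \in 'Z([set: gT]))
    (hg0 : g0 \in 'Z([set: gT]))
    (hg0star : star g0 = g0)
    (hbeta : beta \in beta_words star)
    (hgamma : gamma \in gamma_words gT)
    (hdelta : delta \in delta_words star g0) :
  associative (Qmul beta gamma delta) <->
  (beta, gamma, delta) =
    ([word x y => x * y], [word x y => x * y], [word x y => g0 * x * y])
  \/
  abelian [set: gT] /\
  (beta, gamma, delta) =
    ([word x y => star x * y], [word x y => x * y],
     [word x y => g0 * star x * y]).
Proof.
have [sK sM _] := hstar.
have g0C x : g0 * x = x * g0 by case/centerP: hg0 => _; apply; rewrite inE.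
split.
- case/Qmul_associativeP=> [[A1 A2 A3] [A4 _ A6] _].
  have Eg := gamma_action_eq_mul hgamma A3.
  have gE x y : gamma (x, y) = x * y by rewrite Eg ffunE.
  have bA x y z : beta (x, y * z) = beta (x, y) * z by rewrite -!gE.
  have d11 := delta_word11 hstar hdelta.
  (* Since [gamma (1, z) = z], only the values [delta (x, 1)] remain to be found. *)
  have dE x z : delta (x, z) = delta (x, 1) * z by rewrite -A6 gE mul1g.
  have [Eb | [cG Eb]] := beta_action_eq_mul hstar hbeta A1 bA.
  + left; rewrite Eb Eg; congr (_, _, _); apply/ffunP=> -[x z].
    (* As [beta (x, 1) = x], this gives [delta (x, 1) = x * g0]. *)
    have := A4 x 1 1; rewrite Eb d11 !ffunE /= mulg1 => d1.
    by rewrite dE -d1 g0C.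
  + right; split=> //; rewrite Eb Eg; congr (_, _, _); apply/ffunP=> -[x z].
    (* Here [beta (star x, 1) = x], hence [delta (x, 1) = star x * g0]. *)
    have := A4 (star x) 1 1; rewrite Eb d11 !ffunE /= sK mulg1 => d1.
    by rewrite dE -d1 g0C.
- case=> [[-> -> ->] | [/abelian_setTP cG [-> -> ->]]]; apply/Qmul_associativeP.
  + by split; [split | split |] => x y z; rewrite !ffunE /= ?mulgA ?g0C ?mulgA.
  + split; [split | split |] => x y z;
      rewrite !ffunE /= ?sM ?sK ?hg0star ?mulgA //.
    * by rewrite (cG (star x)).
    * by rewrite -g0C -!mulgA (mulgA x) (cG x) !mulgA.
    * by rewrite -!mulgA (mulgA (star x)) (cG (star x)) !mulgA.
    (* Three factors in [Gu]: [star] is applied to a value of [delta], and [star g0 = g0] has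
       removed the star from [g0]. *)
    * by rewrite (cG (x * g0)) !mulgA.
Qed.
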